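(* Let $T$ be a set of graded formulas and let $\langle q,\varphi\rangle$ be a graded formula. Then $T\vdash_{\mathrm{GRPL}}\langle q,\varphi\rangle$ if and only if $\{\langle 1,\overline{r}\to\psi\rangle\mid\langle r,\psi\rangle\in T\}\vdash_{\mathrm{GRPL}}\langle 1,\overline{q}\to\varphi\rangle$. Moreover, the proof whose existence is asserted on the right-hand side can be chosen in such a way that all graded formulas in the proof have grade $1$.
   Context: Language. Formulas are built from propositional variables and a constant $\overline{q}$ for each rational $q\in[0,1]$, using the basic connectives $\neg$ (unary) and $\to$ (binary); call this language $\mathcal{L}(\mathrm{RPL})$. Abbreviations: $\alpha\oplus\beta$ is $\neg\alpha\to\beta$; $\alpha\odot\beta$ is $\neg(\neg\alpha\oplus\neg\beta)$; $\alpha\wedge\beta$ is $\alpha\odot(\alpha\to\beta)$; $\alpha\equiv\beta$ is $(\alpha\to\beta)\wedge(\beta\to\alpha)$. Operations on rationals in $[0,1]$: $q\to^{Ł}r=\min(1,1-q+r)$, $\neg^{Ł}q=1-q$, $q\odot^{Ł}r=\max(0,q+r-1)$. Łukasiewicz axiom schemata (instances are taken over $\mathcal{L}(\mathrm{RPL})$): (A1) $\varphi\to(\psi\to\varphi)$; (A2) $(\varphi\to\psi)\to((\psi\to\chi)\to(\varphi\to\chi))$; (A3) $((\varphi\to\psi)\to\psi)\to((\psi\to\varphi)\to\varphi)$; (A4) $(\neg\varphi\to\neg\psi)\to(\psi\to\varphi)$. Graded Rational Pavelka logic GRPL. A graded formula is a pair $\langle r,\varphi\rangle$ with $r\in[0,1]$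 rational (the grade) and $\varphi$ a formula of $\mathcal{L}(\mathrm{RPL})$. Axioms of GRPL: (A) $\langle 1,\alpha\rangle$ for each instance $\alpha$ of (A1)–(A4); (B) $\langle q,\overline{q}\rangle$ for each rational $q\in[0,1]$; (C) $\langle 1,\neg\overline{q}\equiv\overline{\neg^{Ł}q}\rangle$ and $\langle 1,(\overline{q}\to\overline{r})\equiv\overline{q\to^{Ł}r}\rangle$ for all rationals $q,r\in[0,1]$; (D) $\langle 0,\varphi\rangle$ for every other formula $\varphi$ of $\mathcal{L}(\mathrm{RPL})$. Rules, for all rationals $q,r\in[0,1]$: graded modus ponens: from $\langle q,\varphi\rangle$ and $\langle r,\varphi\to\psi\rangle$ infer $\langle q\odot^{Ł}r,\psi\rangle$; lifting: from $\langle q,\varphi\rangle$ infer $\langle r\to^{Ł}q,\overline{r}\to\varphi\rangle$. For a set $T$ of graded formulas, a GRPL-proof from $T$ is a finite sequence of graded formulas each of which is an axiom of GRPL, an element of $T$, or follows from earlier elements by one of the two rules; $T\vdash_{\mathrm{GRPL}}\langle q,\varphi\rangle$ means that $\langle q,\varphi\rangle$ is the last element of some GRPL-proof from $T$. *)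

(* Defs.v *)
From HB Require Import structures.
From mathcomp Require Import all_boot all_order all_algebra.

Set Implicit Arguments.
Unset Strict Implicit.
Unset Printing Implicit Defensive.

Import Order.TTheory GRing.Theory Num.Theory.
Local Open Scope ring_scope.

Definition grade : Type := {q : rat | 0 <= q <= 1}.

Fact grade0_subproof : 0 <= (0 : rat) <= 1. Proof. by []. Qed.
Fact grade1_subproof : 0 <= (1 : rat) <= 1. Proof. by []. Qed.

Fact grade_neg_subproof (q : grade) : 0 <= 1 - val q <= 1.
Proof. by case: q => q /= /andP[q0 q1]; rewrite subr_ge0 q1 lerBlDr lerDl. Qed.

Fact grade_imp_subproof (q r : grade) :
  0 <= Num.min 1 (1 - val q + val r) <= 1.
Proof.
case: q r => q /= /andP[q0 q1] [r /= /andP[r0 r1]].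
by rewrite ge_min lexx le_min ler01 /= addr_ge0 ?subr_ge0.
Qed.

Fact grade_tensor_subproof (q r : grade) :
  0 <= Num.max 0 (val q + val r - 1) <= 1.
Proof.
case: q r => q /= /andP[q0 q1] [r /= /andP[r0 r1]].
by rewrite le_max lexx ge_max ler01 /= lerBlDr lerD.
Qed.

Definition grade0 : grade := exist _ 0 grade0_subproof.
Definition grade1 : grade := exist _ 1 grade1_subproof.
Definition grade_neg (q : grade) : grade :=
  exist _ (1 - val q) (grade_neg_subproof q).
Definition grade_imp (q r : grade) : grade :=
  exist _ (Num.min 1 (1 - val q + val r)) (grade_imp_subproof q r).
Definition grade_tensor (q r : grade) : grade :=
  exist _ (Num.max 0 (val q + val r - 1)) (grade_tensor_subproof q r).

Inductive formula : Type :=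
  | Var of nat
  | Const of grade
  | Neg of formula
  | Imp of formula & formula.

Lemma formula_eq_dec : comparable formula.
Proof.
by move=> a b; rewrite /decidable; decide equality; apply: eq_comparable.
Qed.
HB.instance Definition _ := hasDecEq.Build formula (compareP formula_eq_dec).

Definition Oplus (a b : formula) : formula := Imp (Neg a) b.
Definition Odot (a b : formula) : formula := Neg (Oplus (Neg a) (Neg b)).
Definition And (a b : formula) : formula := Odot a (Imp a b).
Definition Equiv (a b : formula) : formula := And (Imp a b) (Imp b a).

Inductive lukasiewicz_axiom : formula -> Prop :=
  | LukA1 a b : lukasiewicz_axiom (Imp a (Imp b a))
  | LukA2 a b c :
      lukasiewicz_axiom (Imp (Imp a b) (Imp (Imp b c) (Imp a c)))
  | LukA3 a b :
      lukasiewicz_axiom (Imp (Imp (Imp a b) b) (Imp (Imp b a) a))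
  | LukA4 a b : lukasiewicz_axiom (Imp (Imp (Neg a) (Neg b)) (Imp b a)).

(* The pair (r, a) is the formula a with grade r. *)
Definition gformula : Type := (grade * formula)%type.

Inductive grpl_axiom_ABC : gformula -> Prop :=
  | GrplA a : lukasiewicz_axiom a -> grpl_axiom_ABC (grade1, a)
  | GrplB q : grpl_axiom_ABC (q, Const q)
  | GrplCneg q :
      grpl_axiom_ABC (grade1, Equiv (Neg (Const q)) (Const (grade_neg q)))
  | GrplCimp q r :
      grpl_axiom_ABC
        (grade1, Equiv (Imp (Const q) (Const r)) (Const (grade_imp q r))).

(* Grade 0 is assigned only to the formulas that no other axiom grades. *)
Inductive grpl_axiom : gformula -> Prop :=
  | GrplABC g : grpl_axiom_ABC g -> grpl_axiom g
  | GrplD a : (forall r, ~ grpl_axiom_ABC (r, a)) -> grpl_axiom (grade0, a).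

Inductive grpl_rule (prev : seq gformula) : gformula -> Prop :=
  | GradedMP q r a b :
      (q, a) \in prev -> (r, Imp a b) \in prev ->
      grpl_rule prev (grade_tensor q r, b)
  | Lifting q r a :
      (q, a) \in prev -> grpl_rule prev (grade_imp r q, Imp (Const r) a).

Definition grpl_proof (T : gformula -> Prop) (p : seq gformula) : Prop :=
  forall p1 g p2, p = p1 ++ g :: p2 ->
    grpl_axiom g \/ T g \/ grpl_rule p1 g.

Definition grpl_proof_of (T : gformula -> Prop) (g : gformula)
    (p : seq gformula) : Prop :=
  grpl_proof T p /\ exists p', p = rcons p' g.

Definition grpl_provable (T : gformula -> Prop) (g : gformula) : Prop :=
  exists p, grpl_proof_of T g p.

Definition internalize (g : gformula) : gformula :=
  (grade1, Imp (Const g.1) g.2).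

Definition internalize_set (T : gformula -> Prop) : gformula -> Prop :=
  fun h => exists2 g, T g & h = internalize g.

(* Main.v *)
(** The proof of <1, q -> a> is obtained by replacing each line <r, b> of a
    proof of <q, a> by the formula r -> b. Graded modus ponens then becomes a
    derivation in Łukasiewicz logic from the bookkeeping axioms, because
    q ⊙ r = ¬(q → ¬r) for grades; the other lines are simpler, and only grade 1
    occurs. Conversely, lifting <r, b> by r itself gives <1, r -> b>, and graded
    modus ponens with the axiom <q, q> turns <1, q -> a> back into <q, a>. *)
Require Import Defs.
From mathcomp Require Import all_boot all_order all_algebra.

Set Implicit Arguments.
Unset Strict Implicit.
Unset Printing Implicit Defensive.

Import Order.TTheory GRing.Theory Num.Theory.
Local Open Scope ring_scope.

(** * Arithmetic of grades *)

Lemma grade_tensor1 (q : grade) : grade_tensor q grade1 = q.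
Proof.
apply: val_inj; case: q => q /= /andP[q0 _].
by rewrite addrK; apply/max_idPr.
Qed.

Lemma grade_impqq (q : grade) : grade_imp q q = grade1.
Proof. by apply: val_inj; rewrite /= subrK minxx. Qed.

Lemma grade_neg0 : grade_neg grade0 = grade1.
Proof. by apply: val_inj; rewrite /= subr0. Qed.

Lemma grade_tensorE (q r : grade) :
  grade_tensor q r = grade_neg (grade_imp q (grade_neg r)).
Proof.
apply: val_inj => /=; rewrite oppr_min addr_maxr subrr !opprD !opprK.
by congr (Num.max _ _); rewrite !addrA subrr add0r addrAC.
Qed.

(** * Extending and concatenating proofs *)

Lemma grpl_rule_sub (p1 p2 : seq gformula) (g : gformula) :
  {subset p1 <= p2} -> grpl_rule p1 g -> grpl_rule p2 g.
Proof.
move=> sub12 [q r a b /sub12 qa /sub12 rab | q r a /sub12 qa].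
- exact: GradedMP qa rab.
- exact: Lifting.
Qed.

Lemma grpl_proof_nil (T : gformula -> Prop) : grpl_proof T [::].
Proof. by case. Qed.

Lemma grpl_proof_rcons (T : gformula -> Prop) (p : seq gformula) (g : gformula) :
  grpl_proof T (rcons p g) <->
  grpl_proof T p /\ (grpl_axiom g \/ T g \/ grpl_rule p g).
Proof.
split=> [pf | [pf step] p1 h p2].
  split; last by apply: (pf p g [::]); rewrite cats1.
  by move=> p1 h p2 def_p; apply: (pf p1 h (rcons p2 g)); rewrite def_p rcons_cat.
case: (lastP p2) => [|p3 k]; first by rewrite cats1 => /rcons_inj[<- <-].
by rewrite -rcons_cons -rcons_cat => /rcons_inj[/pf].
Qed.

Lemma grpl_proof_cat (T : gformula -> Prop) (p1 p2 : seq gformula) :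
  grpl_proof T p1 -> grpl_proof T p2 -> grpl_proof T (p1 ++ p2).
Proof.
move=> pf1; elim/last_ind: p2 => [|p2 g IHp] pf2; first by rewrite cats0.
have [{}/IHp pf step] := (grpl_proof_rcons T p2 g).1 pf2.
rewrite -rcons_cat; apply/grpl_proof_rcons; split=> //.
case: step => [|[|step]]; [by left | by right; left | right; right].
by apply: grpl_rule_sub step => h h_p2; rewrite mem_cat h_p2 orbT.
Qed.

(** A rule needs its premises in one sequence, so the separate proofs of the lines of [p] are
    concatenated first. With [p] empty this covers axioms and hypotheses. *)
Lemma grpl_provable_step (T : gformula -> Prop) (p : seq gformula) (g : gformula) :
  (forall h, h \in p -> grpl_provable T h) ->
  grpl_axiom g \/ T g \/ grpl_rule p g -> grpl_provable T g.
Proof.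
move=> prov step.
suff [p' [pf sub]] : exists p', grpl_proof T p' /\ {subset p <= p'}.
  exists (rcons p' g); split; last by exists p'.
  apply/grpl_proof_rcons; split=> //.
  case: step => [|[|step]]; [by left | by right; left | right; right].
  exact: grpl_rule_sub step.
elim: p prov {step} => [|h p IHp] prov.
  by exists [::]; split=> //; apply: grpl_proof_nil.
have [k pk|p1 [pf1 sub1]] := IHp.
  by apply: prov; rewrite inE pk orbT.
have [p2 [pf2 [p3 def_p2]]] := prov h (mem_head h p).
exists (p1 ++ p2); split; first exact: grpl_proof_cat.
move=> k; rewrite inE mem_cat => /orP[/eqP-> | /sub1->] //.
by rewrite def_p2 mem_rcons mem_head orbT.
Qed.

(* Rational Pavelka logic as the grade-1 fragment of GRPL: lifting is left out,
   since on grade 1 it is derivable from (A1). *)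
Inductive crisp (T : gformula -> Prop) : formula -> Prop :=
  | CrispAx a : grpl_axiom_ABC (grade1, a) -> crisp T a
  | CrispHyp a : T (grade1, a) -> crisp T a
  | CrispMP a b : crisp T a -> crisp T (Imp a b) -> crisp T b.

(** As 1 ⊙ 1 = 1, graded modus ponens never leaves grade 1. *)
Lemma crisp_grpl_proof (T : gformula -> Prop) (a : formula) :
  crisp T a -> exists p, grpl_proof_of T (grade1, a) p /\
                         (forall g, g \in p -> g.1 = grade1).
Proof.
elim=> {a} [a ax | a hyp | a b _ [p1 [[pf1 [p1' def1]] g1]]
                           _ [p2 [[pf2 [p2' def2]] g2]]].
- exists [:: (grade1, a)]; split; last by move=> g; rewrite inE => /eqP->.
  split; last by exists [::].
  apply/(grpl_proof_rcons _ [::]); split; first exact: grpl_proof_nil.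
  by left; apply: GrplABC.
- exists [:: (grade1, a)]; split; last by move=> g; rewrite inE => /eqP->.
  split; last by exists [::].
  apply/(grpl_proof_rcons _ [::]); split; first exact: grpl_proof_nil.
  by right; left.
- exists (rcons (p1 ++ p2) (grade1, b)); split; last first.
    move=> g; rewrite mem_rcons inE mem_cat => /orP[/eqP-> // | /orP[]].
    - exact: g1.
    - exact: g2.
  split; last by exists (p1 ++ p2).
  apply/grpl_proof_rcons; split; first exact: grpl_proof_cat.
  right; right; rewrite -(grade_tensor1 grade1).
  apply: (@GradedMP _ grade1 grade1 a).
  - by rewrite def1 mem_cat mem_rcons mem_head.
  - by rewrite def2 mem_cat mem_rcons mem_head orbT.
Qed.

(** * Derivations in Łukasiewicz logic *)

Section Crisp.
Implicit Types (T : gformula -> Prop) (a b c d : formula).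

Lemma crisp_luk T a : lukasiewicz_axiom a -> crisp T a.
Proof. by move=> ax; apply/CrispAx/GrplA. Qed.

Lemma crisp_weaken T a b : crisp T b -> crisp T (Imp a b).
Proof. by move=> Tb; apply: CrispMP Tb _; apply/crisp_luk/LukA1. Qed.

Lemma crisp_trans T b a c :
  crisp T (Imp a b) -> crisp T (Imp b c) -> crisp T (Imp a c).
Proof.
move=> ab bc; apply: CrispMP bc _; apply: CrispMP ab _.
exact/crisp_luk/LukA2.
Qed.

Lemma crisp_suffix T a b c :
  crisp T (Imp a b) -> crisp T (Imp (Imp b c) (Imp a c)).
Proof. by move=> ab; apply: CrispMP ab _; apply/crisp_luk/LukA2. Qed.

(** (A1) gives a → ((b → a) → a), and (A3) swaps the roles of a and b in the conclusion. *)
Lemma crisp_assertion T a b : crisp T (Imp a (Imp (Imp a b) b)).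
Proof.
by apply: (@crisp_trans _ (Imp (Imp b a) a)); apply: crisp_luk; constructor.
Qed.

Lemma crisp_exchange T a b c :
  crisp T (Imp a (Imp b c)) -> crisp T (Imp b (Imp a c)).
Proof.
move=> abc; apply: crisp_trans (crisp_assertion T b c) _.
exact: crisp_suffix.
Qed.

Lemma crisp_refl T a : crisp T (Imp a a).
Proof.
apply: (@CrispMP _ (Imp a (Imp a a))); first exact/crisp_luk/LukA1.
by apply: crisp_exchange; apply/crisp_luk/LukA1.
Qed.

Lemma crisp_prefix T a b c :
  crisp T (Imp b c) -> crisp T (Imp (Imp a b) (Imp a c)).
Proof.
move=> bc; apply: CrispMP bc _.
by apply: crisp_exchange; apply/crisp_luk/LukA2.
Qed.

Lemma crisp_exfalso T a b : crisp T (Imp (Neg a) (Imp a b)).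
Proof.
by apply: (@crisp_trans _ (Imp (Neg b) (Neg a))); apply: crisp_luk; constructor.
Qed.

Lemma crisp_dne T a : crisp T (Imp (Neg (Neg a)) a).
Proof.
(* The theorem a → a serves as truth: ¬¬a yields ¬a → ¬(a → a), which (A4) turns into (a → a) →
   a. *)
apply: CrispMP (crisp_refl T a) _; apply: crisp_exchange.
apply: crisp_trans (crisp_exfalso T _ (Neg (Imp a a))) _.
exact/crisp_luk/LukA4.
Qed.

Lemma crisp_dni T a : crisp T (Imp a (Neg (Neg a))).
Proof. by apply: CrispMP (crisp_dne T (Neg a)) _; apply/crisp_luk/LukA4. Qed.

Lemma crisp_contra_imp T a b : crisp T (Imp (Imp a b) (Imp (Neg b) (Neg a))).
Proof.
apply: crisp_trans (crisp_suffix b (crisp_dne T a)) _.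
apply: crisp_trans (crisp_prefix _ (crisp_dni T b)) _.
exact/crisp_luk/LukA4.
Qed.

Lemma crisp_contra T a b : crisp T (Imp a b) -> crisp T (Imp (Neg b) (Neg a)).
Proof. by move=> ab; apply: CrispMP ab (crisp_contra_imp T a b). Qed.

Lemma crisp_contraN T a b : crisp T (Imp (Neg a) b) -> crisp T (Imp (Neg b) a).
Proof. by move=> ab; apply: crisp_trans (crisp_contra ab) (crisp_dne T a). Qed.

(** Both [Odot] and, by [grade_tensorE], the product of grades are negated implications; this
    contraposed form fits them. *)
Lemma crisp_curry_contra T a b c :
  crisp T (Imp a (Imp b c)) -> crisp T (Imp (Neg c) (Imp a (Neg b))).
Proof.
by move=> abc; apply: crisp_exchange; apply: crisp_trans abc (crisp_contra_imp _ _ _).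
Qed.

Lemma crisp_odot_elim T a b c :
  crisp T (Imp a (Imp b c)) -> crisp T (Imp (Odot a b) c).
Proof.
move=> /crisp_curry_contra abc; apply: crisp_contraN.
exact: crisp_trans abc (crisp_suffix _ (crisp_dne T a)).
Qed.

(** With x = a → b and y = b → a, [Equiv a b] unfolds to x ⊙ (x → y). Extracting x is (A1);
    extracting y, in the next lemma, is [crisp_assertion]. *)
Lemma crisp_equivl T a b : crisp T (Equiv a b) -> crisp T (Imp a b).
Proof.
move=> ab; apply: CrispMP ab _.
exact/crisp_odot_elim/crisp_luk/LukA1.
Qed.

Lemma crisp_equivr T a b : crisp T (Equiv a b) -> crisp T (Imp b a).
Proof.
move=> ab; apply: CrispMP ab _.
exact/crisp_odot_elim/crisp_assertion.
Qed.

(** * Bookkeeping for constants and translation of single lines *)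

Lemma crisp_bookneg T (q : grade) :
  crisp T (Equiv (Neg (Const q)) (Const (grade_neg q))).
Proof. exact/CrispAx/GrplCneg. Qed.

Lemma crisp_bookimp T (q r : grade) :
  crisp T (Equiv (Imp (Const q) (Const r)) (Const (grade_imp q r))).
Proof. exact/CrispAx/GrplCimp. Qed.

(** The constant 1 is an axiom of grade 1 and bookkeeping makes it imply the negation of the
    constant 0. This handles the axioms of grade 0. *)
Lemma crisp_const0 T a : crisp T (Imp (Const grade0) a).
Proof.
apply: CrispMP (crisp_exfalso T _ _).
apply: CrispMP (crisp_equivr (crisp_bookneg T grade0)).
by rewrite grade_neg0; apply/CrispAx/GrplB.
Qed.

Lemma crisp_tensor T (q r : grade) c :
  crisp T (Imp (Const q) (Imp (Const r) c)) ->
  crisp T (Imp (Const (grade_tensor q r)) c).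
Proof.
move=> /crisp_curry_contra qrc; rewrite grade_tensorE.
apply: crisp_trans (crisp_equivr (crisp_bookneg T _)) _.
(* It remains to collapse q → ¬r, built from constants, to a single constant: first the negation,
   then the implication. *)
apply: crisp_contraN; apply: crisp_trans qrc _.
apply: crisp_trans (crisp_equivl (crisp_bookimp T _ _)).
exact/crisp_prefix/crisp_equivl/crisp_bookneg.
Qed.

Lemma crisp_internalize_MP T (q r : grade) a b :
  crisp T (Imp (Const q) a) -> crisp T (Imp (Const r) (Imp a b)) ->
  crisp T (Imp (Const (grade_tensor q r)) b).
Proof.
by move=> qa /crisp_exchange rab; apply/crisp_tensor/(crisp_trans qa).
Qed.

Lemma crisp_internalize_lifting T (q r : grade) a :
  crisp T (Imp (Const q) a) ->
  crisp T (Imp (Const (grade_imp r q)) (Imp (Const r) a)).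
Proof.
move=> qa; apply: crisp_trans (crisp_equivr (crisp_bookimp T r q)) _.
exact: crisp_prefix.
Qed.

Lemma crisp_internalize_axiom T (g : gformula) :
  grpl_axiom g -> crisp T (Imp (Const g.1) g.2).
Proof.
case=> [{}g [a ax | q | q | q r] | a _] /=.
- exact/crisp_weaken/crisp_luk.
- exact: crisp_refl.
- exact/crisp_weaken/crisp_bookneg.
- exact/crisp_weaken/crisp_bookimp.
- exact: crisp_const0.
Qed.

End Crisp.

(** * Translation of whole proofs in both directions *)

Lemma grpl_proof_crisp (T : gformula -> Prop) (p : seq gformula) (g : gformula) :
  grpl_proof T p -> g \in p ->
  crisp (internalize_set T) (Imp (Const g.1) g.2).
Proof.
elim/last_ind: p g => // p h IHp g /grpl_proof_rcons[pf step].
rewrite mem_rcons inE => /orP[/eqP-> {g} | /(IHp _ pf)] //.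
case: step => [|[Th|]]; first exact: crisp_internalize_axiom.
  by apply: CrispHyp; exists h.
case=> [q r a b /(IHp _ pf) qa /(IHp _ pf) rab | q r a /(IHp _ pf) qa].
- exact: crisp_internalize_MP qa rab.
- exact: crisp_internalize_lifting.
Qed.

Lemma grpl_provable_internalize (T : gformula -> Prop) (g : gformula) :
  T g -> grpl_provable T (internalize g).
Proof.
case: g => r a Tra; rewrite /internalize /= -(grade_impqq r).
apply: (@grpl_provable_step _ [:: (r, a)]); last first.
  by do 2![right]; apply: Lifting; rewrite mem_head.
move=> h; rewrite inE => /eqP->.
by apply: (@grpl_provable_step _ [::]) => //; right; left.
Qed.

(** Every line of the proof from [U] is provable from [T], by induction along that proof; the claim
    is made for all lines because rules refer back to arbitrary earlier ones. *)
Lemma grpl_provable_cut (T U : gformula -> Prop) (g : gformula) :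
  (forall h, U h -> grpl_provable T h) -> grpl_provable U g -> grpl_provable T g.
Proof.
move=> UT [p [pf [p' def_p]]].
have: g \in p by rewrite def_p mem_rcons mem_head.
elim/last_ind: p {p' def_p} g pf => // p h IHp g /grpl_proof_rcons[pf step].
rewrite mem_rcons inE => /orP[/eqP-> {g} | /(IHp _ pf)] //.
case: step => [ax | [/UT // | rule]].
- by apply: (@grpl_provable_step _ [::]) => //; left.
- apply: (@grpl_provable_step _ p) => [k /(IHp _ pf) // |].
  by right; right.
Qed.

Lemma grpl_provable_externalize (T : gformula -> Prop) (q : grade) (a : formula) :
  grpl_provable T (grade1, Imp (Const q) a) -> grpl_provable T (q, a).
Proof.
move=> prov.
apply: (@grpl_provable_step _ [:: (q, Const q); (grade1, Imp (Const q) a)]).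
  move=> h; rewrite !inE => /orP[] /eqP-> //.
  by apply: (@grpl_provable_step _ [::]) => //; left; apply/GrplABC/GrplB.
(* Modus ponens yields grade q ⊙ 1, which is q. *)
right; right; have -> : (q, a) = (grade_tensor q grade1, a).
  by rewrite grade_tensor1.
by apply: (@GradedMP _ q grade1 (Const q)); rewrite !inE eqxx ?orbT.
Qed.

Theorem corollary4p6 (T : gformula -> Prop) (q : grade) (a : formula) :
  (grpl_provable T (q, a) <->
     grpl_provable (internalize_set T) (grade1, Imp (Const q) a)) /\
  (grpl_provable (internalize_set T) (grade1, Imp (Const q) a) ->
     exists p : seq gformula,
       grpl_proof_of (internalize_set T) (grade1, Imp (Const q) a) p /\
       (forall g : gformula, g \in p -> g.1 = grade1)).
Proof.
have internal : grpl_provable T (q, a) ->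
    exists p : seq gformula,
      grpl_proof_of (internalize_set T) (grade1, Imp (Const q) a) p /\
      (forall g : gformula, g \in p -> g.1 = grade1).
  move=> [p [pf [p' def_p]]]; apply: crisp_grpl_proof.
  apply: (@grpl_proof_crisp T p (q, a) pf).
  by rewrite def_p mem_rcons mem_head.
have external : grpl_provable (internalize_set T) (grade1, Imp (Const q) a) ->
    grpl_provable T (q, a).
  move=> prov; apply: grpl_provable_externalize.
  apply: grpl_provable_cut prov.
  by move=> _ [g Tg ->]; apply: grpl_provable_internalize.
(* A given proof on the right may use other grades, so it is taken back to [T] and translated anew
   into one of grade 1. *)
split; last by move=> /external/internal.
by split=> [/internal[p []] | /external] //; exists p.
Qed.
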